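(* Let $\omega,\mu\in\mathbb{C}$ with $\mu\neq 0$, let $q,\alpha,\beta,\gamma,\delta\in\mathbb{C}$ and $g=g(q,\alpha,\beta,\gamma,\delta)$. The matrix elements $A_{lr}(g)$ ($l,r=0,1,2,\dots$) of the operators $B(g)$ of the representation $\uparrow'_{\omega,\mu}$, with respect to the basis $f_m(z)=h_r(z)=z^r$ ($m=-\omega+r$, $r\ge 0$), i.e. the coefficients in $$\exp\big[\mu(qz^2+\beta z+\alpha)+(r-\omega)\delta\big](z+\gamma)^r=\sum_{l=0}^{\infty}A_{lr}(g)\,z^l ,$$ are given as follows. If $r\ge l\ge 0$, then $$A_{lr}(g)=\exp\big(\mu\alpha+(r-\omega)\delta\big)\,\frac{\gamma^{r-l}\,r!}{(r-l)!\,l!}\;F^{1:1;1}_{1:1;1}\left(\begin{matrix}[(-l):2,1]:[(1):1];[(1):1];\\ [(r-l+1):2,1]:[(1):1];[(1):1];\end{matrix}\ \ \mu q\gamma^2,\,-\mu\beta\gamma\right).$$ If $l\ge r\ge 0$, then the matrix element (denoted $A'_{lr}(g)$ in this form) is $$A'_{lr}(g)=\exp\big[\mu\alpha+(r-\omega)\delta\big]\sum_{j=0}^{\infty}\frac{\gamma^{j}\,r!\,(-\mu q)^{\frac{l-r+j}{2}}\,\mathcal{H}_{l-r+j}\!\left(\frac{\mu\beta}{2(-\mu q)^{1/2}}\right)}{(r-j)!\,j!\,(l-r+j)!}.$$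
   Context: $K_5$ is a 5-dimensional complex Lie group whose general element is written $g(q,\alpha,\beta,\gamma,\delta)$ with $q,\alpha,\beta,\gamma,\delta\in\mathbb{C}$; its Lie algebra $\mathcal{K}_5$ has a basis $\mathsf{j}^{\pm},\mathsf{j}^3,\mathcal{E},\mathcal{Q}$ with $[\mathsf{j}^3,\mathcal{Q}]=2\mathcal{Q}$, $[\mathsf{j}^3,\mathsf{j}^\pm]=\pm\mathsf{j}^\pm$, $[\mathsf{j}^-,\mathcal{Q}]=2\mathsf{j}^+$, $[\mathsf{j}^-,\mathsf{j}^+]=\mathcal{E}$ and all other brackets of basis elements zero. The representation $\uparrow'_{\omega,\mu}$ is realized on polynomials in $z$ by $J^3=z\frac{d}{dz}-\omega$, $J^+=\mu z$, $J^-=\frac{d}{dz}$, $E=\mu$, $Q=\mu z^2$; it extends to the multiplier representation on entire functions $$[B(g)f](z)=\exp[\mu(qz^2+\beta z+\alpha)-\omega\delta]\,f(e^{\delta}z+e^{\delta}\gamma),$$ and the matrix elements are defined by $[B(g)h_r](z)=\sum_{l\ge0}A_{lr}(g)h_l(z)$, $h_l(z)=z^l$. The (generalized Lauricella) function used is $$F^{1:1;1}_{1:1;1}\left(\begin{matrix}[(a):2,1]:[(1):1];[(1):1];\\ [(c):2,1]:[(1):1];[(1):1];\end{matrix}\ \ x,y\right)=\sum_{s,k=0}^{\infty}\frac{(a)_{2s+k}(1)_s(1)_k}{(c)_{2s+k}(1)_s(1)_k}\frac{x^s}{s!}\frac{y^k}{k!},$$ where $(a)_n=a(a+1)\cdots(a+n-1)$,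 $(a)_0=1$ is the Pochhammer symbol. $\mathcal{H}_n(x)$ (one argument) is the classical Hermite polynomial, $e^{2xt-t^2}=\sum_{n\ge0}\mathcal{H}_n(x)t^n/n!$, i.e. $\mathcal{H}_n(x)=n!\sum_{i=0}^{[n/2]}\frac{(-1)^i(2x)^{n-2i}}{i!(n-2i)!}$. Conventions: $1/n!=0$ for negative integers $n$ (so the $j$-sum is finite), and $0^0=1$. $(-\mu q)^{1/2}$ is any fixed square root $\sigma$ of $-\mu q$ and $(-\mu q)^{n/2}=\sigma^n$; the product $\sigma^n\mathcal{H}_n(\mu\beta/(2\sigma))=n!\sum_{i=0}^{[n/2]}\frac{(\mu q)^i(\mu\beta)^{n-2i}}{i!(n-2i)!}$ does not depend on the choice of $\sigma$, and this polynomial expression is its meaning when $q=0$. *)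

(* Defs.v *)
From Stdlib Require Export Reals ZArith.
From Coquelicot Require Export Coquelicot.

Open Scope C_scope.

Definition Cexp (z : C) : C :=
  RtoC (exp (Re z)) * (cos (Im z), sin (Im z)).

Definition is_Cseries (u : nat -> C) (s : C) : Prop :=
  @is_series C_AbsRing C_NormedModule u s.

(* The value is meaningful only if the series converges. *)
Definition Cseries (u : nat -> C) : C :=
  @iota (CompleteNormedModule.CompleteSpace _ C_CompleteNormedModule) (is_Cseries u).

(* 1/n!, with the convention 1/n! = 0 for n < 0. *)
Definition inv_fact (n : Z) : C :=
  if (n <? 0)%Z then 0 else / RtoC (INR (fact (Z.to_nat n))).

Fixpoint pochhammer (a : C) (n : nat) : C :=
  match n with
  | O => 1
  | S m => pochhammer a m * (a + INR m)
  end.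

(* F^{1:1;1}_{1:1;1} with parameters [(a):2,1]:[(1):1];[(1):1] over
   [(c):2,1]:[(1):1];[(1):1].  When c is not a non-positive integer, the double
   series converges absolutely, so it may be read as an iterated one. *)
Definition F_lauricella (a c x y : C) : C :=
  Cseries (fun s => Cseries (fun k =>
    (pochhammer a (2 * s + k) * pochhammer 1 s * pochhammer 1 k)
    / (pochhammer c (2 * s + k) * pochhammer 1 s * pochhammer 1 k)
    * (x ^ s / INR (fact s)) * (y ^ k / INR (fact k)))).

Definition hermite (n : nat) (x : C) : C :=
  INR (fact n) *
  sum_n (fun i => (- (1)) ^ i * (2 * x) ^ (n - 2 * i)
                  / (INR (fact i) * INR (fact (n - 2 * i)))) (n / 2).

(* sigma^n H_n(b / (2 sigma)).  For sigma = 0 it is given its polynomial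
   expression, in which - sigma^2 plays the role of mu q. *)
Definition hermite_scaled (n : nat) (sigma b : C) : C :=
  if Ceq_dec sigma 0 then
    INR (fact n) *
    sum_n (fun i => (- sigma ^ 2) ^ i * b ^ (n - 2 * i)
                    / (INR (fact i) * INR (fact (n - 2 * i)))) (n / 2)
  else sigma ^ n * hermite n (b / (2 * sigma)).

Record K5 : Type := mkK5 {
  k5_q : C;
  k5_alpha : C;
  k5_beta : C;
  k5_gamma : C;
  k5_delta : C
}.

(* The multiplier representation obtained from the representation
   uparrow'_{omega,mu} of the Lie algebra of K_5. *)
Definition B (omega mu : C) (g : K5) (f : C -> C) : C -> C := fun z =>
  Cexp (mu * (k5_q g * z ^ 2 + k5_beta g * z + k5_alpha g) - omega * k5_delta g)
  * f (Cexp (k5_delta g) * z + Cexp (k5_delta g) * k5_gamma g).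

Definition h (r : nat) : C -> C := fun z => z ^ r.

(* A l r stands for A_{lr}(g). *)
Definition matrix_elements (omega mu : C) (g : K5) (A : nat -> nat -> C) : Prop :=
  forall (r : nat) (z : C),
    is_Cseries (fun l => A l r * h l z) (B omega mu g (h r) z).

(* Main.v *)
Require Import Defs.
From Stdlib Require Import Reals ZArith Lia Lra.
From Coquelicot Require Import Coquelicot.

(** Since [Cexp delta ^ r = Cexp (r * delta)], the function [B(g) h_r] is a
    constant [K = Cexp (mu * alpha + (r - omega) * delta)] times the product of
    three entire functions
      [exp (mu q z^2)],  [exp (mu beta z)]  and  [(z + gamma)^r],
    each of which is the sum of an everywhere absolutely convergent power
    series.  By Cauchy products ([entire_mult]) the whole product has such an
    expansion, and by uniqueness of power series coefficients
    ([power_series_unique]) every admissible [A l r] is its [l]-th coefficient.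

    The two closed forms come from the two ways of bracketing the triple
    product.  Multiplying [exp (mu beta z)] with [(z + gamma)^r] first gives a
    double sum over [s], [k] with [2 s + k <= l]; this is the Lauricella
    function, whose double series terminates because the upper parameter [- l]
    makes [(- l)_n] vanish for [n > l] ([conv_lauricella]).  Multiplying the two
    exponentials first gives the generating function of the scaled Hermite
    polynomials ([conv_hermite]); its product with the binomial expansion is the
    sum over [j] ([conv_binom_hermite]).  Comparing both with [A l r] through
    uniqueness makes associativity of the Cauchy product unnecessary. *)

Open Scope C_scope.

(** * Finite complex sums *)

(* An equation between finite sums lives in the carrier of a monoid structure
   on C; the algebraic tactics need it at the type C itself. *)
Ltac at_C := try match goal with |- @eq _ ?x ?y => change (@eq C x y) end.
Ltac Cring := at_C; ring.
Ltac Cfield := at_C; field.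

Lemma Csum_S (u : nat -> C) (n : nat) : sum_n u (S n) = sum_n u n + u (S n).
Proof. exact (sum_Sn u n). Qed.

Lemma Csum_first (u : nat -> C) (n : nat) :
  sum_n u (S n) = u 0%nat + sum_n (fun k => u (S k)) n.
Proof.
induction n as [|n IH].
- now rewrite Csum_S, !sum_O.
- rewrite Csum_S, IH, Csum_S. Cring.
Qed.

Lemma Csum_plus (u v : nat -> C) (n : nat) :
  sum_n (fun k => u k + v k) n = sum_n u n + sum_n v n.
Proof. exact (sum_n_plus u v n). Qed.

Lemma Csum_mult_l (c : C) (u : nat -> C) (n : nat) :
  sum_n (fun k => c * u k) n = c * sum_n u n.
Proof. exact (@sum_n_mult_l C_Ring c u n). Qed.

Lemma Csum_eq_0 (u : nat -> C) (n : nat) :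
  (forall k, (k <= n)%nat -> u k = 0) -> sum_n u n = RtoC 0.
Proof.
induction n as [|n IH]; intros H.
- rewrite sum_O; auto.
- rewrite Csum_S, IH, H by auto. Cring.
Qed.

Lemma Csum_drop (u : nat -> C) (d r : nat) :
  (forall k, (k < d)%nat -> u k = 0) ->
  sum_n u (d + r) = sum_n (fun j => u (d + j)%nat) r.
Proof.
revert u; induction d as [|d IH]; intros u H; [reflexivity|].
change (S d + r)%nat with (S (d + r)). rewrite Csum_first, H by lia.
rewrite (IH (fun k => u (S k))) by (intros k Hk; apply H; lia).
apply Cplus_0_l.
Qed.

(** A sum whose odd-indexed terms vanish. *)
Lemma Csum_even (u : nat -> C) (n : nat) :
  (forall k, u (2 * k + 1)%nat = 0) ->
  sum_n u n = sum_n (fun i => u (2 * i)%nat) (n / 2).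
Proof.
intros H.
assert (D : forall m, (2 * m / 2 = m)%nat /\ ((2 * m + 1) / 2 = m)%nat).
{ intros m; split.
  - rewrite Nat.mul_comm; apply Nat.div_mul; lia.
  - rewrite Nat.add_comm, Nat.mul_comm, Nat.div_add by lia. reflexivity. }
assert (E : forall m, sum_n u (2 * m) = sum_n (fun i => u (2 * i)%nat) m).
{ induction m as [|m IH].
  - now rewrite !sum_O.
  - replace (2 * S m)%nat with (S (S (2 * m))) by lia.
    rewrite !Csum_S, IH.
    replace (S (2 * m)) with (2 * m + 1)%nat by lia. rewrite H.
    replace (2 * S m)%nat with (S (2 * m + 1)) by lia. Cring. }
destruct (Nat.Even_or_Odd n) as [[m ->]|[m ->]].
- rewrite (proj1 (D m)). apply E.
- rewrite (proj2 (D m)), <- E.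
  replace (2 * m + 1)%nat with (S (2 * m)) by lia.
  rewrite Csum_S. replace (S (2 * m)) with (2 * m + 1)%nat by lia.
  rewrite H. Cring.
Qed.

Lemma Re_sum (u : nat -> C) (n : nat) :
  Re (sum_n u n) = sum_n (fun k => Re (u k)) n.
Proof.
induction n as [|n IH]; [now rewrite !sum_O|].
rewrite Csum_S, sum_Sn, <- IH. reflexivity.
Qed.

Lemma Im_sum (u : nat -> C) (n : nat) :
  Im (sum_n u n) = sum_n (fun k => Im (u k)) n.
Proof.
induction n as [|n IH]; [now rewrite !sum_O|].
rewrite Csum_S, sum_Sn, <- IH. reflexivity.
Qed.

(** * Convergence of complex series *)

Lemma is_Cseries_components (u : nat -> C) (s : C) :
  is_Cseries u s <->
  is_series (fun n => Re (u n)) (Re s) /\ is_series (fun n => Im (u n)) (Im s).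
Proof.
unfold is_Cseries, is_series. split.
- intros H; split.
  + apply filterlim_ext with (fun n => Re (sum_n u n)); [intros n; apply Re_sum|].
    eapply filterlim_comp; [exact H|].
    intros P [e He]. exists e. intros y Hy. apply He. apply Hy.
  + apply filterlim_ext with (fun n => Im (sum_n u n)); [intros n; apply Im_sum|].
    eapply filterlim_comp; [exact H|].
    intros P [e He]. exists e. intros y Hy. apply He. apply Hy.
- intros [H1 H2] P [e He].
  assert (F1 : eventually (fun n =>
    ball (Re s) e (sum_n (fun n => Re (u n)) n)))
    by exact (H1 _ (locally_ball (Re s) e)).
  assert (F2 : eventually (fun n =>
    ball (Im s) e (sum_n (fun n => Im (u n)) n)))
    by exact (H2 _ (locally_ball (Im s) e)).
  generalize (filter_and _ _ F1 F2). unfold filtermap; apply filter_imp.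
  intros n [B1 B2]. apply He. split.
  + change (ball (Re s) e (Re (sum_n u n))). now rewrite Re_sum.
  + change (ball (Im s) e (Im (sum_n u n))). now rewrite Im_sum.
Qed.

Lemma is_Cseries_ext (u v : nat -> C) (s : C) :
  (forall n, u n = v n) -> is_Cseries u s -> is_Cseries v s.
Proof. apply is_series_ext. Qed.

Lemma is_Cseries_scal (c : C) (u : nat -> C) (s : C) :
  is_Cseries u s -> is_Cseries (fun n => c * u n) (c * s).
Proof. exact (is_series_scal c u s). Qed.

Lemma is_Cseries_finite (u : nat -> C) (N : nat) :
  (forall n, (N < n)%nat -> u n = 0) -> is_Cseries u (sum_n u N).
Proof.
intros H.
assert (E : forall n, (N <= n)%nat -> sum_n u N = sum_n u n).
{ induction 1 as [|n Hn IH]; [reflexivity|].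
  rewrite Csum_S, <- IH, H by lia. symmetry; apply Cplus_0_r. }
apply filterlim_ext_loc with (fun _ : nat => sum_n u N).
- exists N. exact E.
- apply filterlim_const.
Qed.

Lemma Cseries_unique (u : nat -> C) (s : C) : is_Cseries u s -> Cseries u = s.
Proof.
intros H.
apply (@iota_unique C_AbsRing C_CompleteNormedModule (is_Cseries u)); [|exact H].
intros t Ht. exact (filterlim_locally_unique _ _ _ Ht H).
Qed.

Lemma Cseries_finite (u : nat -> C) (N : nat) :
  (forall n, (N < n)%nat -> u n = 0) -> Cseries u = sum_n u N.
Proof. intros H; now apply Cseries_unique, is_Cseries_finite. Qed.

(** The even- and odd-indexed parts of a series, obtained from the
    corresponding statement on power series at the point 1. *)
Lemma is_series_odd_even (a : nat -> R) (l1 l2 : R) :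
  is_series (fun n => a (2 * n)%nat) l1 ->
  is_series (fun n => a (2 * n + 1)%nat) l2 ->
  is_series a (l1 + l2)%R.
Proof.
intros H1 H2.
assert (H : is_pseries a 1 (l1 + 1 * l2)%R).
{ apply is_pseries_odd_even; apply is_pseries_R;
  (eapply is_series_ext; [|eassumption]); intros n; simpl;
  rewrite !Rmult_1_l, pow1, Rmult_1_r; reflexivity. }
apply is_pseries_R in H. rewrite Rmult_1_l in H.
eapply is_series_ext; [|exact H].
intros n; simpl. now rewrite pow1, Rmult_1_r.
Qed.

Lemma is_series_zero : is_series (fun _ : nat => 0%R) 0%R.
Proof.
apply filterlim_ext with (fun _ : nat => 0%R).
- intros n. rewrite sum_n_const. now rewrite Rmult_0_r.
- apply filterlim_const.
Qed.

(** * Cauchy products *)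

(** The Cauchy product of two sequences. *)
Definition conv (a b : nat -> C) (n : nat) : C :=
  sum_n (fun k => a k * b (n - k)%nat) n.

(** Absolute convergence of a complex series. *)
Definition abs_summable (u : nat -> C) : Prop :=
  ex_series (fun n => Cmod (u n)).

Lemma abs_summable_ext (u v : nat -> C) :
  (forall n, u n = v n) -> abs_summable u -> abs_summable v.
Proof. intros E. apply ex_series_ext. intros n. now rewrite E. Qed.

Lemma abs_summable_Re (u : nat -> C) :
  abs_summable u -> ex_series (fun n => Rabs (Re (u n))).
Proof.
intros H. apply (ex_series_le (V := R_CompleteNormedModule)) with (2 := H).
intros n. unfold norm; simpl. unfold abs; simpl.
rewrite Rabs_Rabsolu. apply Rle_trans with (2 := Rmax_Cmod (u n)).
apply Rmax_l.
Qed.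

Lemma abs_summable_Im (u : nat -> C) :
  abs_summable u -> ex_series (fun n => Rabs (Im (u n))).
Proof.
intros H. apply (ex_series_le (V := R_CompleteNormedModule)) with (2 := H).
intros n. unfold norm; simpl. unfold abs; simpl.
rewrite Rabs_Rabsolu. apply Rle_trans with (2 := Rmax_Cmod (u n)).
apply Rmax_r.
Qed.

(** Mertens' theorem for complex series: the real and imaginary parts of the
    product are combinations of four real Cauchy products. *)
Lemma is_Cseries_conv (a b : nat -> C) (s t : C) :
  is_Cseries a s -> is_Cseries b t -> abs_summable a -> abs_summable b ->
  is_Cseries (conv a b) (s * t).
Proof.
intros Ha Hb Aa Ab.
apply is_Cseries_components in Ha; destruct Ha as [Ha1 Ha2].
apply is_Cseries_components in Hb; destruct Hb as [Hb1 Hb2].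
pose proof (abs_summable_Re _ Aa) as Aa1. pose proof (abs_summable_Im _ Aa) as Aa2.
pose proof (abs_summable_Re _ Ab) as Ab1. pose proof (abs_summable_Im _ Ab) as Ab2.
apply is_Cseries_components; split.
- eapply is_series_ext.
  2: exact (is_series_minus _ _ _ _ (is_series_mult _ _ _ _ Ha1 Hb1 Aa1 Ab1)
                                    (is_series_mult _ _ _ _ Ha2 Hb2 Aa2 Ab2)).
  intros n; unfold conv. rewrite Re_sum, sum_n_Reals.
  symmetry. exact (minus_sum _ _ n).
- eapply is_series_ext.
  2: exact (is_series_plus _ _ _ _ (is_series_mult _ _ _ _ Ha1 Hb2 Aa1 Ab2)
                                   (is_series_mult _ _ _ _ Ha2 Hb1 Aa2 Ab1)).
  intros n; unfold conv. rewrite Im_sum, sum_n_Reals.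
  symmetry. exact (plus_sum _ _ n).
Qed.

Lemma abs_summable_conv (a b : nat -> C) :
  abs_summable a -> abs_summable b -> abs_summable (conv a b).
Proof.
intros [s Ha] [t Hb].
assert (H := is_series_mult_pos _ _ _ _ Ha Hb
  (fun n => Cmod_ge_0 _) (fun n => Cmod_ge_0 _)).
apply (ex_series_le (V := R_CompleteNormedModule))
  with (2 := ex_intro _ _ H : ex_series _).
intros n. unfold norm; simpl. unfold abs; simpl.
rewrite Rabs_pos_eq by apply Cmod_ge_0.
unfold conv. generalize n at 2 4 as m. induction m as [|m IH].
- rewrite sum_O. simpl. rewrite Cmod_mult. apply Rle_refl.
- rewrite Csum_S. simpl.
  eapply Rle_trans; [apply Cmod_triangle|].
  apply Rplus_le_compat; [exact IH|]. rewrite Cmod_mult. apply Rle_refl.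
Qed.

(** [spread c] is the coefficient sequence of [f (z ^ 2)] when [c] is that of
    [f z]. *)
Definition spread (c : nat -> C) (n : nat) : C :=
  if Nat.even n then c (n / 2)%nat else 0.

Lemma spread_even (c : nat -> C) (n : nat) : spread c (2 * n) = c n.
Proof.
unfold spread. rewrite Nat.even_mul. simpl Nat.even.
rewrite Nat.mul_comm, Nat.div_mul by lia. reflexivity.
Qed.

Lemma spread_odd (c : nat -> C) (n : nat) : spread c (2 * n + 1) = 0.
Proof.
unfold spread. rewrite Nat.even_add, Nat.even_mul. reflexivity.
Qed.

Lemma conv_spread (c d : nat -> C) (n : nat) :
  conv (spread c) d n = sum_n (fun i => c i * d (n - 2 * i)%nat) (n / 2).
Proof.
unfold conv. rewrite Csum_even.
- apply sum_n_ext; intros i. now rewrite spread_even.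
- intros k. rewrite spread_odd. Cring.
Qed.

(** * The exponential series *)

Lemma Cfact_neq_0 (n : nat) : RtoC (INR (fact n)) <> 0.
Proof. intros H. apply (INR_fact_neq_0 n). now apply RtoC_inj. Qed.

Lemma Cfact_S (n : nat) :
  RtoC (INR (fact (S n))) = RtoC (INR (S n)) * RtoC (INR (fact n)).
Proof. change (fact (S n)) with (S n * fact n)%nat. now rewrite mult_INR, RtoC_mult. Qed.

Lemma CINR_S_neq_0 (n : nat) : RtoC (INR (S n)) <> 0.
Proof. intros H. apply (not_0_INR (S n)); [lia|]. now apply RtoC_inj. Qed.

Lemma Cmult_cancel_l (c x y : C) : c <> 0 -> c * x = c * y -> x = y.
Proof.
intros Hc H. rewrite <- (Cmult_1_l x), <- (Cmult_1_l y), <- (Cinv_l c Hc).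
now rewrite <- !Cmult_assoc, H.
Qed.

(** The general term [z ^ n / n!] of the exponential series. *)
Definition exp_term (z : C) (n : nat) : C := z ^ n / INR (fact n).

Lemma exp_term_S (z : C) (n : nat) :
  INR (S n) * exp_term z (S n) = z * exp_term z n.
Proof.
unfold exp_term. rewrite Cfact_S, Cpow_S.
Cfield. split; [apply Cfact_neq_0 | apply CINR_S_neq_0].
Qed.

(** The binomial theorem, divided by [n!]. *)
Lemma conv_exp_term (z w : C) (n : nat) :
  conv (exp_term z) (exp_term w) n = exp_term (z + w) n.
Proof.
induction n as [|n IH].
- unfold conv. rewrite sum_O. unfold exp_term; simpl. Cfield.
- apply (Cmult_cancel_l (INR (S n))); [apply CINR_S_neq_0|].
  rewrite exp_term_S, <- IH. unfold conv at 1.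
  rewrite <- Csum_mult_l.
  (* Each summand is multiplied by S n, split as k + (S n - k). *)
  rewrite (sum_n_ext_loc _ (fun k =>
    (INR k * exp_term z k) * exp_term w (S n - k)
    + exp_term z k * (INR (S n - k) * exp_term w (S n - k)))).
  2: { intros k Hk. rewrite minus_INR, RtoC_minus by assumption. Cring. }
  rewrite Csum_plus, Csum_first, (Csum_S (fun k => exp_term z k * _)).
  rewrite (sum_n_ext_loc (fun k => exp_term z k * (INR (S n - k) * exp_term w (S n - k)))
    (fun k => w * (exp_term z k * exp_term w (n - k)))).
  2: { intros k Hk. rewrite Nat.sub_succ_l by assumption.
       rewrite exp_term_S. Cring. }
  rewrite (sum_n_ext (fun k => INR (S k) * exp_term z (S k) * _)
    (fun k => z * (exp_term z k * exp_term w (n - k)))).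
  2: { intros k. rewrite exp_term_S. simpl Nat.sub. Cring. }
  rewrite !Csum_mult_l, Nat.sub_diag. unfold conv. simpl INR. Cring.
Qed.

Lemma abs_summable_exp_term (z : C) : abs_summable (exp_term z).
Proof.
exists (exp (Cmod z)).
eapply is_series_ext; [|exact (proj1 (is_pseries_R _ _ _) (is_exp_Reals (Cmod z)))].
intros n; simpl. unfold exp_term.
rewrite Cmod_div by apply Cfact_neq_0.
rewrite Cmod_pow, Cmod_R, Rabs_pos_eq by apply pos_INR.
unfold Rdiv; apply Rmult_comm.
Qed.

Lemma is_Cseries_exp_real (x : R) : is_Cseries (exp_term x) (exp x).
Proof.
assert (E : forall n, exp_term x n = RtoC (/ INR (fact n) * x ^ n)%R).
{ intros n. unfold exp_term. rewrite RtoC_mult, RtoC_inv, RtoC_pow by apply INR_fact_neq_0.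
  unfold Cdiv. Cring. }
apply is_Cseries_components; split.
- eapply is_series_ext; [|exact (proj1 (is_pseries_R _ _ _) (is_exp_Reals x))].
  intros n; cbv beta. rewrite E. reflexivity.
- eapply is_series_ext; [|exact is_series_zero].
  intros n; cbv beta. rewrite E. reflexivity.
Qed.

Lemma exp_term_imag_even (y : R) (n : nat) :
  exp_term (0%R, y) (2 * n) = RtoC (cos_n n * (Rsqr y) ^ n)%R.
Proof.
unfold exp_term, cos_n. rewrite Cpow_mult_r.
replace ((0%R, y) ^ 2) with (RtoC (- Rsqr y)%R).
2: { unfold Rsqr; simpl. unfold Cmult, RtoC; simpl. f_equal; ring. }
rewrite <- RtoC_pow, <- RtoC_div by apply INR_fact_neq_0.
f_equal. replace (- Rsqr y)%R with (-1 * Rsqr y)%R by ring.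
rewrite Rpow_mult_distr. Cfield. apply INR_fact_neq_0.
Qed.

Lemma exp_term_imag_odd (y : R) (n : nat) :
  exp_term (0%R, y) (2 * n + 1) = (0%R, (sin_n n * (Rsqr y) ^ n * y)%R).
Proof.
unfold exp_term, sin_n. rewrite Cpow_add_r, Cpow_mult_r, Cpow_1_r.
replace ((0%R, y) ^ 2) with (RtoC (- Rsqr y)%R).
2: { unfold Rsqr; simpl. unfold Cmult, RtoC; simpl. f_equal; ring. }
rewrite <- RtoC_pow. unfold Cdiv. rewrite <- RtoC_inv by apply INR_fact_neq_0.
replace (- Rsqr y)%R with (-1 * Rsqr y)%R by ring.
rewrite Rpow_mult_distr. unfold Cmult, RtoC; cbv [fst snd].
f_equal; [ring | field; apply INR_fact_neq_0].
Qed.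

Lemma is_Cseries_exp_imag (y : R) : is_Cseries (exp_term (0%R, y)) (cos y, sin y).
Proof.
apply is_Cseries_components.
change (Re (cos y, sin y)) with (cos y). change (Im (cos y, sin y)) with (sin y).
split.
- rewrite <- (Rplus_0_r (cos y)). apply is_series_odd_even.
  + unfold cos. destruct (exist_cos (Rsqr y)) as [l Hl].
    apply is_series_Reals in Hl. eapply is_series_ext; [|exact Hl].
    intros n. now rewrite exp_term_imag_even.
  + eapply is_series_ext; [|exact is_series_zero].
    intros n. now rewrite exp_term_imag_odd.
- rewrite <- (Rplus_0_l (sin y)). apply is_series_odd_even.
  + eapply is_series_ext; [|exact is_series_zero].
    intros n. now rewrite exp_term_imag_even.
  + unfold sin. destruct (exist_sin (Rsqr y)) as [l Hl].
    apply is_series_Reals in Hl. rewrite Rmult_comm.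
    eapply is_series_ext; [|exact (is_series_scal_r y _ _ Hl)].
    intros n. now rewrite exp_term_imag_odd.
Qed.

(** [Cexp] is defined from the real exponential, cosine and sine; its power
    series is the Cauchy product of those of [exp x] and [exp (i y)]. *)
Lemma is_Cseries_Cexp (z : C) : is_Cseries (exp_term z) (Cexp z).
Proof.
unfold Cexp.
eapply is_Cseries_ext.
2: exact (is_Cseries_conv _ _ _ _ (is_Cseries_exp_real (Re z))
    (is_Cseries_exp_imag (Im z)) (abs_summable_exp_term _) (abs_summable_exp_term _)).
intros n. rewrite conv_exp_term. f_equal.
destruct z as [x y]. unfold Cplus, RtoC; simpl. f_equal; ring.
Qed.

Lemma Cexp_plus (z w : C) : Cexp (z + w) = Cexp z * Cexp w.
Proof.
destruct z as [x y], w as [x' y']. unfold Cexp, Cplus, Cmult, RtoC; simpl.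
rewrite exp_plus, cos_plus, sin_plus. f_equal; ring.
Qed.

Lemma Cexp_INR (n : nat) (z : C) : Cexp (INR n * z) = Cexp z ^ n.
Proof.
induction n as [|n IH].
- simpl INR. rewrite Cmult_0_l. unfold Cexp; simpl.
  rewrite exp_0, cos_0, sin_0. unfold Cmult; simpl.
  unfold RtoC; f_equal; ring.
- rewrite S_INR, RtoC_plus, Cpow_S, <- IH, <- Cexp_plus. f_equal; ring.
Qed.

(** * Power series with infinite radius of convergence *)

(** [entire c f]: the power series with coefficients [c] converges absolutely
    to [f] on the whole complex plane. *)
Definition entire (c : nat -> C) (f : C -> C) : Prop :=
  forall z, is_Cseries (fun n => c n * z ^ n) (f z)
            /\ abs_summable (fun n => c n * z ^ n).

Lemma conv_pow (a b : nat -> C) (z : C) (n : nat) :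
  conv (fun k => a k * z ^ k) (fun k => b k * z ^ k) n = conv a b n * z ^ n.
Proof.
unfold conv. rewrite Cmult_comm, <- Csum_mult_l.
apply sum_n_ext_loc. intros k Hk.
replace (z ^ n) with (z ^ k * z ^ (n - k)); [Cring|].
rewrite <- Cpow_add_r. f_equal; lia.
Qed.

Lemma entire_mult (a b : nat -> C) (f g : C -> C) :
  entire a f -> entire b g -> entire (conv a b) (fun z => f z * g z).
Proof.
intros Ha Hb z. destruct (Ha z) as [Ha1 Ha2], (Hb z) as [Hb1 Hb2]. split.
- eapply is_Cseries_ext; [intros n; apply conv_pow|].
  now apply is_Cseries_conv.
- eapply abs_summable_ext; [intros n; apply conv_pow|].
  now apply abs_summable_conv.
Qed.

Lemma entire_exp (b : C) : entire (exp_term b) (fun z => Cexp (b * z)).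
Proof.
assert (E : forall z n, exp_term (b * z) n = exp_term b n * z ^ n).
{ intros z n. unfold exp_term. rewrite Cpow_mult_l. unfold Cdiv; ring. }
intros z; split.
- eapply is_Cseries_ext; [intros n; apply E|]. apply is_Cseries_Cexp.
- eapply abs_summable_ext; [intros n; apply E|]. apply abs_summable_exp_term.
Qed.

Lemma entire_spread (c : nat -> C) (f : C -> C) :
  entire c f -> entire (spread c) (fun z => f (z ^ 2)).
Proof.
intros H z. destruct (H (z ^ 2)) as [H1 [s H2]].
assert (E : forall n, spread c (2 * n) * z ^ (2 * n) = c n * (z ^ 2) ^ n).
{ intros n. now rewrite spread_even, Cpow_mult_r. }
assert (O : forall n, spread c (2 * n + 1) * z ^ (2 * n + 1) = 0).
{ intros n. rewrite spread_odd. Cring. }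
apply is_Cseries_components in H1; destruct H1 as [Hr Hi].
split; [apply is_Cseries_components; split|].
- rewrite <- (Rplus_0_r (Re _)). apply is_series_odd_even.
  + eapply is_series_ext; [|exact Hr]. intros n; cbv beta. now rewrite <- E.
  + eapply is_series_ext; [|exact is_series_zero]. intros n. now rewrite O.
- rewrite <- (Rplus_0_r (Im _)). apply is_series_odd_even.
  + eapply is_series_ext; [|exact Hi]. intros n; cbv beta. now rewrite <- E.
  + eapply is_series_ext; [|exact is_series_zero]. intros n. now rewrite O.
- exists (s + 0)%R. apply is_series_odd_even.
  + eapply is_series_ext; [|exact H2]. intros n; cbv beta. now rewrite <- E.
  + eapply is_series_ext; [|exact is_series_zero]. intros n. now rewrite O, Cmod_0.
Qed.

(** The coefficient of [z ^ j] in [(z + gamma) ^ r]. *)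
Definition binom_coef (r : nat) (gamma : C) (j : nat) : C :=
  if (j <=? r)%nat
  then INR (fact r) * gamma ^ (r - j) / (INR (fact j) * INR (fact (r - j)))
  else 0.

Lemma entire_binom (r : nat) (gamma : C) :
  entire (binom_coef r gamma) (fun z => (z + gamma) ^ r).
Proof.
intros z.
assert (Z : forall n, (r < n)%nat -> binom_coef r gamma n * z ^ n = 0).
{ intros n Hn. unfold binom_coef. rewrite (proj2 (Nat.leb_gt n r)) by assumption. Cring. }
split.
- replace ((z + gamma) ^ r) with (sum_n (fun n => binom_coef r gamma n * z ^ n) r).
  + now apply is_Cseries_finite.
  + transitivity (INR (fact r) * conv (exp_term z) (exp_term gamma) r).
    * unfold conv. rewrite <- Csum_mult_l. apply sum_n_ext_loc. intros k Hk.
      unfold binom_coef, exp_term. rewrite (proj2 (Nat.leb_le k r)) by assumption.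
      Cfield. split; apply Cfact_neq_0.
    * rewrite conv_exp_term. unfold exp_term. Cfield. apply Cfact_neq_0.
- apply ex_series_incr_n with (S r).
  exists 0%R. eapply is_series_ext; [|exact is_series_zero].
  intros k. rewrite Z by lia. now rewrite Cmod_0.
Qed.

Lemma real_power_series_unique (a b : nat -> R) (f : R -> R) :
  (forall x, is_series (fun n => a n * x ^ n)%R (f x)) ->
  (forall x, is_series (fun n => b n * x ^ n)%R (f x)) ->
  forall n, a n = b n.
Proof.
assert (P : forall c, (forall x, is_series (fun n => c n * x ^ n)%R (f x)) ->
  Rbar_lt 0 (CV_radius c)).
{ intros c H. destruct (Rbar_lt_dec 0 (CV_radius c)) as [|N]; [assumption|].
  exfalso. apply Rbar_not_lt_le in N.
  (* Convergence at 1 contradicts a radius of convergence 0. *)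
  apply (CV_disk_outside c 1%R).
  - apply Rbar_le_lt_trans with (1 := N). simpl. rewrite Rabs_R1. lra.
  - apply (ex_series_lim_0 (fun n => c n * 1 ^ n)%R). now exists (f 1%R). }
intros Ha Hb n. apply PSeries_ext_recip; [now apply P|now apply P|].
apply filter_forall. intros x. unfold PSeries.
rewrite (is_series_unique _ _ (Ha x)). symmetry. apply is_series_unique, Hb.
Qed.

(** Comparing real and imaginary parts on the real axis reduces uniqueness to
    the case of real power series. *)
Lemma power_series_unique (a b : nat -> C) (f : C -> C) :
  (forall z, is_Cseries (fun n => a n * z ^ n) (f z)) ->
  (forall z, is_Cseries (fun n => b n * z ^ n) (f z)) ->
  forall n, a n = b n.
Proof.
assert (P : forall c, (forall z, is_Cseries (fun n => c n * z ^ n) (f z)) ->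
  (forall x : R, is_series (fun n => Re (c n) * x ^ n)%R (Re (f x))) /\
  (forall x : R, is_series (fun n => Im (c n) * x ^ n)%R (Im (f x)))).
{ intros c H; split; intros x; generalize (H (RtoC x)); intros Hx;
  apply is_Cseries_components in Hx; destruct Hx as [Hr Hi].
  - eapply is_series_ext; [|exact Hr]. intros n; simpl.
    rewrite <- RtoC_pow. unfold Re, Cmult, RtoC; simpl. Cring.
  - eapply is_series_ext; [|exact Hi]. intros n; simpl.
    rewrite <- RtoC_pow. unfold Re, Im, Cmult, RtoC; simpl. Cring. }
intros Ha Hb n. destruct (P a Ha) as [Ar Ai], (P b Hb) as [Br Bi].
pose proof (real_power_series_unique _ _ (fun x => Re (f x)) Ar Br n).
pose proof (real_power_series_unique _ _ (fun x => Im (f x)) Ai Bi n).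
now apply injective_projections.
Qed.

(** * Closed forms of the coefficients *)

Lemma pochhammer_opp_INR (l n : nat) : (n <= l)%nat ->
  pochhammer (- INR l) n = (- (1)) ^ n * INR (fact l) / INR (fact (l - n)).
Proof.
induction n as [|n IH]; intros H.
- rewrite Nat.sub_0_r. simpl. Cfield. apply Cfact_neq_0.
- simpl pochhammer. rewrite IH by lia.
  replace (l - n)%nat with (S (l - S n)) by lia.
  rewrite Cfact_S, Cpow_S.
  replace (- INR l + INR n) with (- INR (S (l - S n))).
  2: { replace (INR l) with (INR (S (l - S n) + n)) by (f_equal; lia).
       rewrite plus_INR, RtoC_plus. Cring. }
  Cfield. split; [apply Cfact_neq_0|apply CINR_S_neq_0].
Qed.

Lemma pochhammer_opp_INR_0 (l n : nat) : (l < n)%nat -> pochhammer (- INR l) n = 0.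
Proof.
induction 1 as [|n H IH]; simpl pochhammer; [|rewrite IH]; ring.
Qed.

Lemma pochhammer_INR (m n : nat) :
  pochhammer (INR (m + 1)) n = INR (fact (m + n)) / INR (fact m).
Proof.
induction n as [|n IH]; simpl pochhammer.
- rewrite Nat.add_0_r. Cfield. apply Cfact_neq_0.
- rewrite IH, <- (plus_n_Sm m n), Cfact_S, <- RtoC_plus, <- plus_INR.
  replace (m + 1 + n)%nat with (S (m + n)) by lia.
  Cfield. apply Cfact_neq_0.
Qed.

Lemma pochhammer_1 (n : nat) : pochhammer 1 n = INR (fact n).
Proof.
change (RtoC 1) with (RtoC (INR (0 + 1))). rewrite (pochhammer_INR 0 n).
simpl. field.
Qed.

(** The Lauricella series terminates when its upper parameter is [- l]. *)
Lemma F_lauricella_opp_INR (l m : nat) (x y : C) :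
  F_lauricella (- INR l) (INR (m + 1)) x y =
  sum_n (fun s => sum_n (fun k =>
    (- (1)) ^ k * INR (fact l) * INR (fact m)
    / (INR (fact (l - (2 * s + k))) * INR (fact (m + (2 * s + k))))
    * exp_term x s * exp_term y k) (l - 2 * s)) (l / 2).
Proof.
unfold F_lauricella.
rewrite (Cseries_finite _ (l / 2)).
- apply sum_n_ext_loc. intros s Hs.
  assert (Hs' : (2 * s <= l)%nat).
  { pose proof (Nat.Div0.mul_div_le l 2). lia. }
  rewrite (Cseries_finite _ (l - 2 * s)).
  + apply sum_n_ext_loc. intros k Hk.
    rewrite pochhammer_opp_INR, pochhammer_INR, !pochhammer_1 by lia.
    replace ((- (1)) ^ (2 * s + k)) with ((- (1)) ^ k).
    2: { rewrite Cpow_add_r, Cpow_mult_r.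
         replace ((- (1)) ^ 2) with (RtoC 1) by (simpl; ring).
         rewrite Cpow_1_l. Cring. }
    unfold exp_term. Cfield. repeat split; apply Cfact_neq_0.
  + intros k Hk. rewrite pochhammer_opp_INR_0 by lia.
    unfold Cdiv. Cring.
- intros s Hs.
  assert (Hs' : (l < 2 * s)%nat).
  { pose proof (Nat.div_mod_eq l 2). pose proof (Nat.mod_upper_bound l 2). lia. }
  rewrite (Cseries_finite _ 0).
  + rewrite sum_O, pochhammer_opp_INR_0 by lia. unfold Cdiv. Cring.
  + intros k Hk. rewrite pochhammer_opp_INR_0 by lia. unfold Cdiv. Cring.
Qed.

(** Coefficient of [z ^ l] in
    [exp (a * z ^ 2) * (exp (b * z) * (z + gamma) ^ r)], for [l <= r]. *)
Lemma conv_lauricella (a b gamma : C) (l r : nat) : (l <= r)%nat ->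
  conv (spread (exp_term a)) (conv (exp_term b) (binom_coef r gamma)) l =
  gamma ^ (r - l) * INR (fact r) / (INR (fact (r - l)) * INR (fact l))
  * F_lauricella (- INR l) (INR (r - l + 1)) (a * gamma ^ 2) (- (b * gamma)).
Proof.
intros H. rewrite conv_spread, F_lauricella_opp_INR, <- Csum_mult_l.
apply sum_n_ext_loc. intros s Hs.
assert (Hs' : (2 * s <= l)%nat).
{ pose proof (Nat.Div0.mul_div_le l 2). lia. }
unfold conv. rewrite <- !Csum_mult_l.
apply sum_n_ext_loc. intros k Hk.
unfold binom_coef. rewrite (proj2 (Nat.leb_le (l - 2 * s - k) r)) by lia.
replace (l - 2 * s - k)%nat with (l - (2 * s + k))%nat by lia.
replace (r - (l - (2 * s + k)))%nat with (r - l + (2 * s + k))%nat by lia.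
unfold exp_term.
replace (- (b * gamma)) with (- (1) * (b * gamma)) by ring.
rewrite !Cpow_mult_l, !Cpow_add_r, Cpow_mult_r.
assert (E : (- (1)) ^ k * (- (1)) ^ k = 1).
{ rewrite <- Cpow_mult_l. replace (- (1) * - (1)) with (RtoC 1) by ring.
  apply Cpow_1_l. }
(* The sign of the Pochhammer quotient cancels that of [(- b * gamma) ^ k]. *)
transitivity (((- (1)) ^ k * (- (1)) ^ k) *
  (a ^ s / INR (fact s) * (b ^ k / INR (fact k) *
   (INR (fact r) * (gamma ^ (r - l) * ((gamma ^ 2) ^ s * gamma ^ k)) /
   (INR (fact (l - (2 * s + k))) * INR (fact (r - l + (2 * s + k)))))))).
- rewrite E. Cring.
- Cfield. repeat split; apply Cfact_neq_0.
Qed.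

(** The expansion of [exp (- sigma ^ 2 * z ^ 2) * exp (b * z)] has coefficients
    [hermite_scaled n sigma b / n!]. *)
Lemma conv_hermite (sigma b : C) (n : nat) :
  conv (spread (exp_term (- sigma ^ 2))) (exp_term b) n =
  hermite_scaled n sigma b / INR (fact n).
Proof.
rewrite conv_spread. unfold hermite_scaled.
destruct (Ceq_dec sigma 0) as [Z|N].
- unfold Cdiv. rewrite Cmult_comm, Cmult_assoc, Cinv_l, Cmult_1_l by apply Cfact_neq_0.
  apply sum_n_ext. intros i. unfold exp_term. Cfield. split; apply Cfact_neq_0.
- unfold hermite.
  transitivity (sigma ^ n * sum_n (fun i => (- (1)) ^ i
    * (2 * (b / (2 * sigma))) ^ (n - 2 * i)
    / (INR (fact i) * INR (fact (n - 2 * i)))) (n / 2)).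
  2: { field. apply Cfact_neq_0. }
  rewrite <- Csum_mult_l. apply sum_n_ext_loc. intros i Hi.
  assert (Hi' : (2 * i <= n)%nat).
  { pose proof (Nat.Div0.mul_div_le n 2). lia. }
  replace (2 * (b / (2 * sigma))) with (b * / sigma) by (field; exact N).
  unfold exp_term.
  replace (- sigma ^ 2) with (- (1) * sigma ^ 2) by ring.
  rewrite !Cpow_mult_l, Cpow_inv by exact N.
  replace (sigma ^ n) with ((sigma ^ 2) ^ i * sigma ^ (n - 2 * i)).
  2: { rewrite <- Cpow_mult_r, <- Cpow_add_r. f_equal; lia. }
  Cfield. repeat split; try apply Cfact_neq_0. now apply Cpow_nz.
Qed.

(** Coefficient of [z ^ l] in
    [(exp (- sigma ^ 2 * z ^ 2) * exp (b * z)) * (z + gamma) ^ r], for [r <= l].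
    The index [j] of the series is [k - (l - r)], where [k] is the index of the
    Hermite factor in the Cauchy product: the terms with [k < l - r] vanish
    because the degree [l - k] then exceeds [r]. *)
Lemma conv_binom_hermite (sigma b gamma : C) (l r : nat) : (r <= l)%nat ->
  conv (conv (spread (exp_term (- sigma ^ 2))) (exp_term b)) (binom_coef r gamma) l =
  Cseries (fun j =>
    gamma ^ j * INR (fact r) * hermite_scaled (l - r + j) sigma b
    * inv_fact (Z.of_nat r - Z.of_nat j)
    / (INR (fact j) * INR (fact (l - r + j)))).
Proof.
intros H. rewrite (Cseries_finite _ r).
- unfold conv at 1.
  match goal with |- sum_n ?u l = _ =>
    replace (sum_n u l) with (sum_n u ((l - r) + r)) by (f_equal; lia) end.
  rewrite Csum_drop.
  + apply sum_n_ext_loc. intros j Hj. rewrite conv_hermite.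
    unfold binom_coef, inv_fact.
    replace (l - (l - r + j))%nat with (r - j)%nat by lia.
    rewrite (proj2 (Nat.leb_le (r - j) r)) by lia.
    rewrite (proj2 (Z.ltb_ge _ _)) by lia.
    replace (Z.to_nat (Z.of_nat r - Z.of_nat j)) with (r - j)%nat by lia.
    replace (r - (r - j))%nat with j by lia.
    Cfield. repeat split; apply Cfact_neq_0.
  + intros k Hk. unfold binom_coef.
    rewrite (proj2 (Nat.leb_gt (l - k) r)) by lia. Cring.
- intros j Hj. unfold inv_fact. rewrite (proj2 (Z.ltb_lt _ _)) by lia.
  unfold Cdiv. Cring.
Qed.

(** * Matrix elements *)

(** The factor [Cexp delta ^ r] is absorbed into the exponential, which turns
    [- omega * delta] into [(r - omega) * delta]. *)
Lemma B_h_factor (omega mu q alpha beta gamma delta : C) (r : nat) (z : C) :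
  B omega mu (mkK5 q alpha beta gamma delta) (h r) z =
  Cexp (mu * (q * z ^ 2 + beta * z + alpha) + (INR r - omega) * delta)
  * (z + gamma) ^ r.
Proof.
unfold B, h; simpl k5_q; simpl k5_alpha; simpl k5_beta; simpl k5_gamma; simpl k5_delta.
replace (Cexp delta * z + Cexp delta * gamma) with (Cexp delta * (z + gamma)) by ring.
rewrite Cpow_mult_l, <- Cexp_INR, Cmult_assoc, <- Cexp_plus.
f_equal. f_equal. Cring.
Qed.

Theorem theorem2p1 (omega mu : C) (Hmu : mu <> 0)
    (q alpha beta gamma delta : C) :
  let g := mkK5 q alpha beta gamma delta in
  (exists A : nat -> nat -> C, matrix_elements omega mu g A) /\
  (forall A : nat -> nat -> C, matrix_elements omega mu g A ->
    (forall (r : nat) (z : C),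
      is_Cseries (fun l => A l r * z ^ l)
        (Cexp (mu * (q * z ^ 2 + beta * z + alpha) + (INR r - omega) * delta)
         * (z + gamma) ^ r)) /\
    (forall l r : nat, (l <= r)%nat ->
      A l r =
        Cexp (mu * alpha + (INR r - omega) * delta)
        * (gamma ^ (r - l) * INR (fact r) / (INR (fact (r - l)) * INR (fact l)))
        * F_lauricella (- INR l) (INR (r - l + 1))
            (mu * q * gamma ^ 2) (- (mu * beta * gamma))) /\
    (forall (sigma : C), sigma ^ 2 = - (mu * q) ->
      forall l r : nat, (r <= l)%nat ->
      A l r =
        Cexp (mu * alpha + (INR r - omega) * delta)
        * Cseries (fun j =>
            gamma ^ j * INR (fact r) * hermite_scaled (l - r + j) sigma (mu * beta)
            * inv_fact (Z.of_nat r - Z.of_nat j)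
            / (INR (fact j) * INR (fact (l - r + j)))))).
Proof.
intros g.
set (K := fun r => Cexp (mu * alpha + (INR r - omega) * delta)).
set (u := spread (exp_term (mu * q))).
set (v := exp_term (mu * beta)).
assert (Hu := entire_spread _ _ (entire_exp (mu * q))). fold u in Hu.
assert (Hv := entire_exp (mu * beta)). fold v in Hv.
assert (H1 : forall r z, is_Cseries
  (fun l => K r * conv u (conv v (binom_coef r gamma)) l * z ^ l)
  (B omega mu g (h r) z)).
{ intros r z.
  replace (B omega mu g (h r) z) with
    (K r * (Cexp (mu * q * z ^ 2) * (Cexp (mu * beta * z) * (z + gamma) ^ r))).
  - eapply is_Cseries_ext; [intros n; apply Cmult_assoc|].
    apply is_Cseries_scal.
    exact (proj1 (entire_mult _ _ _ _ Hu
      (entire_mult _ _ _ _ Hv (entire_binom r gamma)) z)).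
  - unfold g, K. rewrite B_h_factor, !Cmult_assoc, <- !Cexp_plus.
    f_equal. f_equal. Cring. }
assert (H2 : forall r z, is_Cseries
  (fun l => K r * conv (conv u v) (binom_coef r gamma) l * z ^ l)
  (B omega mu g (h r) z)).
{ intros r z.
  replace (B omega mu g (h r) z) with
    (K r * ((Cexp (mu * q * z ^ 2) * Cexp (mu * beta * z)) * (z + gamma) ^ r)).
  - eapply is_Cseries_ext; [intros n; apply Cmult_assoc|].
    apply is_Cseries_scal.
    exact (proj1 (entire_mult _ _ _ _ (entire_mult _ _ _ _ Hu Hv)
      (entire_binom r gamma) z)).
  - unfold g, K. rewrite B_h_factor, !Cmult_assoc, <- !Cexp_plus.
    f_equal. f_equal. Cring. }
split.
- exists (fun l r => K r * conv u (conv v (binom_coef r gamma)) l). exact H1.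
- intros A HA. split; [|split].
  + intros r z. rewrite <- B_h_factor. exact (HA r z).
  + intros l r H.
    rewrite (power_series_unique _ _ _ (HA r) (H1 r) l).
    unfold u, v. rewrite conv_lauricella by assumption. apply Cmult_assoc.
  + intros sigma Hs l r H.
    rewrite (power_series_unique _ _ _ (HA r) (H2 r) l).
    unfold u, v. replace (mu * q) with (- sigma ^ 2) by (rewrite Hs; ring).
    rewrite conv_binom_hermite by assumption. reflexivity.
Qed.
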